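(* Let $A\in\mathbb{R}^{n\times n}$, $B\in\mathbb{R}^{n\times m}$ and let $Q\in\mathbb{R}^{n\times n}$ be symmetric. Suppose that there exists a real symmetric matrix $K_0\in\mathbb{R}^{n\times n}$ with $-A^TK_0-K_0A-Q+K_0BB^TK_0=0$. Then $(A,B)$ is controllable if and only if the set of real symmetric matrices $K\in\mathbb{R}^{n\times n}$ satisfying $$-A^TK-KA-Q+KBB^TK\le 0$$ is bounded.
   Context: All solutions are real symmetric matrices. For symmetric matrices, $R\le 0$ means that $R$ is negative semidefinite. A set of matrices is bounded if it is bounded in (any) norm on $\mathbb{R}^{n\times n}$. The pair $(A,B)$ is controllable if $[B\; AB\;\cdots\; A^{n-1}B]$ has rank $n$. *)

(* Defs.v *)
From mathcomp Require Export all_boot all_order all_algebra.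
From mathcomp Require Export classical_sets reals topology normedtype.

Set Implicit Arguments.
Unset Strict Implicit.
Unset Printing Implicit Defensive.

Import GRing.Theory Num.Theory.

Local Open Scope ring_scope.
Local Open Scope classical_set_scope.

(* The block matrix [B, A B, ..., A^(n-1) B]. *)
Definition ctrb_mx (R : realType) (n m : nat) (A : 'M[R]_n) (B : 'M[R]_(n, m))
    : 'M[R]_(n, \sum_(i < n) m) :=
  \mxrow_(i < n) (A ^+ i *m B).

Definition controllable (R : realType) (n m : nat)
    (A : 'M[R]_n) (B : 'M[R]_(n, m)) : Prop :=
  \rank (ctrb_mx A B) = n.

Definition neg_semidef (R : realType) (n : nat) (M : 'M[R]_n) : Prop :=
  M^T = M /\ forall x : 'cV[R]_n, (x^T *m M *m x) 0 0 <= 0.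

Definition riccati (R : realType) (n m : nat)
    (A : 'M[R]_n) (B : 'M[R]_(n, m)) (Q K : 'M[R]_n) : 'M[R]_n :=
  - (A^T *m K) - K *m A - Q + K *m B *m B^T *m K.

(* Main.v *)
(* Put D = K - K0 and A0 = A - B B^T K0; the Riccati inequality becomes
   D B B^T D <= A0^T D + D A0.

   If (A, B) is controllable, dividing by |D| -> oo shows that B^T D / |D| -> 0.
   Whenever D v / |D| -> 0, the form of the positive semidefinite matrix
   (A0^T D + D A0) / |D| tends to 0 at v, hence so does its product with v, and
   D A0 v / |D| -> 0. Thus D / |D| -> 0 on the span of the columns of all
   A^i B, which is absurd; no subsequence of D / |D| has to be extracted.

   If (A, B) is not controllable, let the rows of W span the left kernel of the
   controllability matrix, so that W B = 0 and W A = F W. There is a nonzero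
   symmetric X with F^T X + X F equal to 0 or to the identity, according to
   whether the Lyapunov operator of F on symmetric matrices is singular or not.
   All K0 + t W^T X W with t >= 0 are then solutions. *)
From HB Require Import structures.
Require Import Defs.
From mathcomp Require Import ring lra.
Set Implicit Arguments.
Unset Strict Implicit.
Unset Printing Implicit Defensive.

Import Order.TTheory GRing.Theory Num.Theory.
Import numFieldNormedType.Exports.
Local Open Scope ring_scope.
Local Open Scope classical_set_scope.

(** * The Lyapunov equation on symmetric matrices *)

Section Lyapunov.
Variables (R : numFieldType) (d : nat) (F : 'M[R]_d).

(* On symmetric matrices this is twice the Lyapunov operator; the summand
   [Y - Y^T] forces solutions with symmetric right-hand side to be symmetric. *)
Definition sym_lyapunov (Y : 'M[R]_d) : 'M[R]_d :=
  F^T *m (Y + Y^T) + (Y + Y^T) *m F + (Y - Y^T).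

Fact sym_lyapunov_is_linear : linear sym_lyapunov.
Proof.
move=> a Y Z; rewrite /sym_lyapunov !linearP /=.
have -> : a *: Y + Z + (a *: Y^T + Z^T) = a *: (Y + Y^T) + (Z + Z^T).
  by rewrite scalerDr addrACA.
rewrite mulmxDr mulmxDl -!scalemxAr -!scalemxAl !scalerDr.
rewrite [X in _ + X = _]addrACA [RHS]addrACA; congr (_ + _).
exact: addrACA.
Qed.

HB.instance Definition _ := GRing.isLinear.Build R 'M[R]_d 'M[R]_d _
  sym_lyapunov sym_lyapunov_is_linear.

(** The first two summands of [sym_lyapunov Y] form a symmetric matrix and [Y - Y^T] is
    antisymmetric, so a symmetric value forces [Y - Y^T = 0]. *)
Lemma sym_lyapunov_sym (Y S : 'M[R]_d) :
  S^T = S -> sym_lyapunov Y = S ->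
  Y^T = Y /\ F^T *m (Y *+ 2) + (Y *+ 2) *m F = S.
Proof.
rewrite /sym_lyapunov => symS eqS.
set G := _ + _ *m F in eqS.
have symG : G^T = G.
  have symZ : (Y + Y^T)^T = Y + Y^T by rewrite linearD /= trmxK addrC.
  by rewrite /G linearD /= !trmx_mul trmxK symZ [LHS]addrC.
have : Y - Y^T = - (Y - Y^T).
  apply: (addrI G); rewrite eqS -[in LHS]symS -eqS.
  by rewrite linearD /= symG linearB /= trmxK opprB.
move/eqP; rewrite -addr_eq0 -mulr2n -scaler_nat scaler_eq0 pnatr_eq0 subr_eq0.
move=> /eqP symY.
split; first by rewrite -symY.
by rewrite -eqS /G -symY subrr addr0 mulr2n.
Qed.

(** An invertible [sym_lyapunov] attains the identity, a singular one has a nonzero kernel element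
    [Y]. Both targets are symmetric, so [X = 2 Y] serves in either case. *)
Lemma lyapunov_exists : (0 < d)%N ->
  exists X : 'M[R]_d, [/\ X^T = X, X != 0 &
    F^T *m X + X *m F = 0 \/ F^T *m X + X *m F = 1%:M].
Proof.
move=> d_gt0.
have [Lfree|] := boolP (row_free (lin_mx sym_lyapunov)).
  have Lunit : lin_mx sym_lyapunov \in unitmx by rewrite -row_free_unit.
  pose Y : 'M_d := vec_mx (mxvec 1%:M *m invmx (lin_mx sym_lyapunov)).
  have eqY : sym_lyapunov Y = 1%:M.
    apply: (can_inj mxvecK).
    by rewrite -mul_vec_lin vec_mxK mulmxKV.
  have [symY eq1] := sym_lyapunov_sym (trmx1 _ _) eqY.
  exists (Y *+ 2); split; last by right.
    by rewrite linearMn /= symY.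
  apply/eqP => Y0; move: eq1; rewrite Y0 mulmx0 mul0mx addr0.
  move/matrixP/(_ (Ordinal d_gt0) (Ordinal d_gt0)); rewrite !mxE eqxx.
  by move/eqP; rewrite eq_sym oner_eq0.
rewrite -kermx_eq0 => /rowV0Pn [u /sub_kermxP uL u0].
have eqY : sym_lyapunov (vec_mx u) = 0.
  by apply: (can_inj mxvecK); rewrite -mul_vec_lin vec_mxK uL linear0.
have [symY eq0] := sym_lyapunov_sym (trmx0 _ _ _) eqY.
exists (vec_mx u *+ 2); split; last by left.
  by rewrite linearMn /= symY.
rewrite -scaler_nat scaler_eq0 pnatr_eq0; apply: contra u0 => /eqP Y0.
by rewrite -[u]vec_mxK Y0 linear0.
Qed.

End Lyapunov.

(** * The left kernel of the controllability matrix *)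

Lemma mulmx_pow_dim (F : fieldType) (n p m : nat)
    (W : 'M[F]_(p, n)) (A : 'M[F]_n) (B : 'M[F]_(n, m)) :
  (forall i : 'I_n, W *m (A ^+ i *m B) = 0) -> W *m (A ^+ n *m B) = 0.
Proof.
case: n => [|n] in W A B *; first by rewrite thinmx0 mul0mx.
(* The leading terms cancel in [q], so by Cayley-Hamilton [A ^+ n.+1 = q(A)] is a combination of
   lower powers. *)
move=> WAB; pose q := 'X^(n.+1) - char_poly A.
have szq : (size q <= n.+1)%N.
  apply/leq_sizeP => j; rewrite leq_eqVlt coefB coefXn => /orP[/eqP <-|ltj].
    have /monicP := char_poly_monic A.
    by rewrite eqxx lead_coefE size_char_poly /= => ->; rewrite subrr.
  by rewrite gtn_eqF // nth_default ?subr0 // size_char_poly.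
have -> : A ^+ n.+1 = \sum_(i < n.+1) q`_i *: A ^+ i.
  transitivity (horner_mx A q).
    by rewrite rmorphB /= Cayley_Hamilton subr0 rmorphXn /= horner_mx_X.
  have -> : horner_mx A q = horner_mx A (\sum_(i < n.+1) q`_i *: 'X^i).
    congr (horner_mx A _); rewrite -poly_def; apply/polyP => i; rewrite coef_poly.
    by case: ltnP => // le_ni; rewrite nth_default // (leq_trans szq).
  rewrite linear_sum /=; apply: eq_bigr => i _.
  by rewrite linearZ /= rmorphXn /= horner_mx_X.
rewrite mulmx_suml mulmx_sumr big1 // => i _.
by rewrite -scalemxAl -scalemxAr WAB scaler0.
Qed.

Lemma uncontrollable_subspace (R : realType) (n m : nat)
    (A : 'M[R]_n) (B : 'M[R]_(n, m)) : ~ controllable A B ->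
  exists (d : nat) (W : 'M[R]_(d, n)) (F : 'M[R]_d),
    [/\ (0 < d)%N, row_free W, W *m B = 0 & W *m A = F *m W].
Proof.
move=> /eqP nctrb; pose C := ctrb_mx A B; pose W := row_base (kermx C).
have WC : W *m C = 0.
  by apply/sub_kermxP; rewrite /W eq_row_base.
have WAB (i : 'I_n) : W *m (A ^+ i *m B) = 0.
  move: WC; rewrite /C /ctrb_mx mul_mxrow -(@mxrow0 _ _ (fun=> m)).
  by move/eq_mxrowP/(_ i).
(* For [n = 0] the pair is controllable. The index [0] thus exists, and [WAB] there gives
   [W *m B = 0]. *)
have n_gt0 : (0 < n)%N.
  rewrite lt0n; apply: contra nctrb => /eqP n0.
  by rewrite eqn_leq rank_leq_row [X in (X <= _)%N]n0.
(* Multiplication by [A] shifts the blocks [A ^+ i *m B]; only the last one leaves the range and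
   needs [mulmx_pow_dim]. *)
have /submxP [F WA] : (W *m A <= W)%MS.
  rewrite {2}/W eq_row_base; apply/sub_kermxP.
  rewrite /C /ctrb_mx mul_mxrow -(@mxrow0 _ _ (fun=> m)).
  apply/eq_mxrowP => i; rewrite -mulmxA [A *m (_ *m _)]mulmxA.
  rewrite -[A *m _]/(A * _) -exprS.
  have [lt_in|] := ltnP i.+1 n; first exact: (WAB (Ordinal lt_in)).
  move=> le_ni; have -> : i.+1 = n by apply/eqP; rewrite eqn_leq le_ni ltn_ord.
  exact: mulmx_pow_dim.
exists (\rank (kermx C)), W, F; split=> //.
- by rewrite mxrank_ker subn_gt0 ltn_neqAle nctrb rank_leq_row.
- exact: row_base_free.
- by have := WAB (Ordinal n_gt0); rewrite expr0 mul1mx.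
Qed.

(** * Expansion of the Riccati map around [K0] *)

Lemma dotmx_ge0 (R : realDomainType) (n : nat) (x : 'cV[R]_n) :
  0 <= (x^T *m x) 0 0.
Proof. by rewrite mxE sumr_ge0 // => i _; rewrite mxE -expr2 sqr_ge0. Qed.

Section RiccatiShift.
Variables (R : realType) (n m : nat) (A : 'M[R]_n) (B : 'M[R]_(n, m)).
Variables (Q K0 : 'M[R]_n).

Lemma riccati_tr (K : 'M[R]_n) :
  Q^T = Q -> K^T = K -> (riccati A B Q K)^T = riccati A B Q K.
Proof.
move=> symQ symK; rewrite /riccati !(linearD, linearN) /= !trmx_mul !trmxK.
by rewrite symQ symK !mulmxA [- _ - (_ *m A)]addrC.
Qed.

Lemma riccati_shift (D : 'M[R]_n) : K0^T = K0 ->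
  let A0 := A - B *m B^T *m K0 in
  riccati A B Q (K0 + D) =
  riccati A B Q K0 - (A0^T *m D + D *m A0) + D *m B *m B^T *m D.
Proof.
move=> symK0 A0; rewrite /riccati /A0 linearB /= !trmx_mul trmxK symK0.
rewrite !(mulmxDl, mulmxDr, mulmxBl, mulmxBr, mulNmx, mulmxN) !mulmxA.
have addE i j (M N : 'M[R]_n) : (M + N) i j = M i j + N i j by rewrite mxE.
have oppE i j (M : 'M[R]_n) : (- M) i j = - M i j by rewrite mxE.
by apply/matrixP => i j; rewrite !(addE, oppE); ring.
Qed.

End RiccatiShift.

(** * An unbounded ray of solutions without controllability *)

Lemma uncontrollable_unbounded (R : realType) (n m : nat)
    (A : 'M[R]_n) (B : 'M[R]_(n, m)) (Q K0 : 'M[R]_n) :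
  Q^T = Q -> K0^T = K0 -> riccati A B Q K0 = 0 -> ~ controllable A B ->
  ~ bounded_set [set K : 'M[R]_n | K^T = K /\ neg_semidef (riccati A B Q K)].
Proof.
move=> symQ symK0 ricK0 /uncontrollable_subspace[d [W [F [d_gt0 Wfree WB WA]]]].
have [X [symX X0 lyapX]] := lyapunov_exists F d_gt0.
pose D := W^T *m X *m W.
have symD : D^T = D by rewrite /D !trmx_mul trmxK symX mulmxA.
have D0 : D != 0.
  (* A right inverse [V] of [W] recovers [X] as [V^T *m D *m V]. *)
  have /row_freeP [V WV] := Wfree.
  apply: contra X0 => /eqP eqD; apply/eqP.
  have : V^T *m D *m V = 0 by rewrite eqD mulmx0 mul0mx.
  by rewrite /D -!mulmxA WV mulmx1 mulmxA -trmx_mul WV trmx1 mul1mx.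
have DB : D *m B = 0 by rewrite /D -mulmxA WB mulmx0.
pose A0 := A - B *m B^T *m K0.
have WA0 : W *m A0 = F *m W.
  by rewrite /A0 mulmxBr !mulmxA WB !mul0mx subr0.
have lyapD : A0^T *m D + D *m A0 = W^T *m (F^T *m X + X *m F) *m W.
  rewrite /D !mulmxA -trmx_mul WA0 -[_ *m A0]mulmxA WA0 trmx_mul.
  by rewrite mulmxDr mulmxDl !mulmxA.
have lyapD_ge0 (x : 'cV_n) : 0 <= (x^T *m (A0^T *m D + D *m A0) *m x) 0 0.
  rewrite lyapD; case: lyapX => ->; first by rewrite !(mulmx0, mul0mx) mxE.
  by rewrite mulmx1 mulmxA -trmx_mul -mulmxA dotmx_ge0.
have solD t : 0 <= t ->
    (K0 + t *: D)^T = K0 + t *: D /\ neg_semidef (riccati A B Q (K0 + t *: D)).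
  move=> t0; have symKt : (K0 + t *: D)^T = K0 + t *: D.
    by rewrite linearD linearZ /= symK0 symD.
  split=> //; split; first exact: riccati_tr.
  move=> x; rewrite riccati_shift // ricK0 -/A0 sub0r.
  rewrite -!scalemxAr -!scalemxAl -scalerDr DB !mul0mx !scaler0 addr0.
  by rewrite mulmxN mulNmx mxE oppr_le0 -scalemxAr -scalemxAl mxE mulr_ge0.
case/pinfty_ex_gt0 => M M_gt0 /= boundM.
have normD : 0 < `|D| by rewrite normr_gt0.
(* Here [t * |D| = M + |K0| + 1], whereas a bound [M] on the solutions would give
   [t * |D| <= M + |K0|]. *)
pose t := (M + `|K0| + 1) / `|D|.
have t0 : 0 <= t by rewrite divr_ge0 ?addr_ge0 ?normr_ge0 ?(ltW M_gt0) ?ler01.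
have := boundM _ (solD t t0).
have := ler_normB (K0 + t *: D) K0.
rewrite addrAC subrr add0r normrZ ger0_norm // divfK ?gt_eqF //.
by move=> le1 le2; have := le_trans le1 (lerD le2 (lexx _)); rewrite gerDl ler10.
Qed.

(** * Functions of lower order than the norm *)

Lemma quadratic_bound (R : realFieldType) (a b c r : R) : 0 < r ->
  (forall s : R, 0 <= s ^+ 2 * a + s * b + c) -> `|b| <= r * a + c / r.
Proof.
move=> r0 nonneg; have rV0 : 0 < r^-1 by rewrite invr_gt0.
have scale s : 0 <= (s ^+ 2 * a + s * b + c) * r^-1 by rewrite mulr_ge0 ?(ltW rV0).
(* Nonnegativity at [s = r] and [s = - r], divided by [r], bounds [b] from both sides. *)
have ep : (r ^+ 2 * a + r * b + c) * r^-1 = r * a + b + c / r by field; lra.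
have em : ((- r) ^+ 2 * a + (- r) * b + c) * r^-1 = r * a - b + c / r.
  by field; lra.
have := scale r; have := scale (- r); rewrite ep em => ? ?.
by rewrite ler_norml; apply/andP; split; lra.
Qed.

Section Negligible.
Variables (R : realType) (n : nat) (S : set 'M[R]_n).

(** This is [f D = o(|D|)] as [|D|] tends to infinity within [S]; it holds vacuously when [S] is
    bounded. *)
Definition negligible_on (f : 'M[R]_n -> R) : Prop :=
  forall e : R, 0 < e ->
    exists M : R, forall D, S D -> M <= `|D| -> `|f D| <= e * `|D|.

Lemma eq_negligible (f g : 'M[R]_n -> R) :
  (forall D, S D -> f D = g D) -> negligible_on f -> negligible_on g.
Proof.
move=> fg f0 e /f0[M bM]; exists M => D SD MD; rewrite -fg //; exact: bM.
Qed.

Lemma negligibleD (f g : 'M[R]_n -> R) :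
  negligible_on f -> negligible_on g -> negligible_on (fun D => f D + g D).
Proof.
move=> f0 g0 e e0; have e20 : 0 < e / 2 by rewrite divr_gt0.
have [M bM] := f0 _ e20; have [N bN] := g0 _ e20.
exists (Num.max M N) => D SD; rewrite ge_max => /andP[MD ND].
rewrite (le_trans (ler_normD _ _)) // [e]splitr mulrDl.
by rewrite lerD ?bM ?bN.
Qed.

Lemma negligibleN (f : 'M[R]_n -> R) :
  negligible_on f -> negligible_on (fun D => - f D).
Proof.
by move=> f0 e /f0[M bM]; exists M => D SD MD; rewrite normrN bM.
Qed.

Lemma negligible_norm (f : 'M[R]_n -> R) :
  negligible_on f -> negligible_on (fun D => `|f D|).
Proof.
by move=> f0 e /f0[M bM]; exists M => D SD MD; rewrite normr_id bM.
Qed.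

Lemma negligible_sum (I : Type) (r : seq I) (f : I -> 'M[R]_n -> R) :
  (forall i, negligible_on (f i)) ->
  negligible_on (fun D => \sum_(i <- r) f i D).
Proof.
move=> f0; elim: r => [|i r IHr].
  move=> e e0; exists 0 => D _ _.
  by rewrite big_nil normr0 mulr_ge0 ?normr_ge0 ?ltW.
apply: eq_negligible (negligibleD (f0 i) IHr) => D _ /=.
by rewrite big_cons.
Qed.

(* The last hypothesis amounts to [f^2 <= 4 q g], where [q] is [O(|D|)] and [g]
   is [o(|D|)]. *)
Lemma negligible_quadratic (c : R) (q f g : 'M[R]_n -> R) :
    (forall D, S D -> q D <= c * `|D|) -> negligible_on g ->
    (forall D, S D -> forall s, 0 <= s ^+ 2 * q D + s * f D + g D) ->
  negligible_on f.
Proof.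
move=> qc g0 nonneg e e0; pose c1 := `|c| + 1.
have c1_gt0 : 0 < c1 by rewrite ltr_wpDl ?normr_ge0.
(* With this [r], and tolerance [r * (e / 2)] for [g], both [r * q D] and [g D / r] are at most
   [e / 2 * |D|]. *)
pose r := e / 2 / c1; have r0 : 0 < r by rewrite !divr_gt0.
have [|M bM] := g0 (r * (e / 2)); first by rewrite !mulr_gt0 ?invr_gt0.
exists M => D SD MD; apply: le_trans (quadratic_bound r0 (nonneg D SD)) _.
rewrite [e]splitr mulrDl lerD //.
  have -> : e / 2 = r * c1 by rewrite /r divfK ?gt_eqF.
  rewrite -mulrA ler_pM2l //; apply: le_trans (qc D SD) _.
  rewrite ler_wpM2r ?normr_ge0 // /c1.
  by rewrite (le_trans (ler_norm c)) // lerDl.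
rewrite ler_pdivrMr //; apply: le_trans (ler_norm _) _.
by apply: le_trans (bM D SD MD) _; rewrite [r * _]mulrC mulrAC.
Qed.

Lemma negligible_cst (c : R) : negligible_on (fun=> c).
Proof.
move=> e e0; exists (`|c| / e) => D _.
by rewrite ler_pdivrMr // [`|D| * e]mulrC.
Qed.

End Negligible.

(** * Bilinear forms and the entrywise maximum norm *)

Definition mx_form (R : pzRingType) (n : nat) (D : 'M[R]_n) (x y : 'cV[R]_n) : R :=
  (x^T *m D *m y) 0 0.

Section MxForm.
Variables (R : comPzRingType) (n : nat) (D : 'M[R]_n).

Lemma mx_formDl x y z : mx_form D (x + y) z = mx_form D x z + mx_form D y z.
Proof. by rewrite /mx_form linearD /= !mulmxDl mxE. Qed.

Lemma mx_formDr x y z : mx_form D z (x + y) = mx_form D z x + mx_form D z y.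
Proof. by rewrite /mx_form mulmxDr mxE. Qed.

Lemma mx_formZl a x z : mx_form D (a *: x) z = a * mx_form D x z.
Proof. by rewrite /mx_form linearZ /= -!scalemxAl mxE. Qed.

Lemma mx_formZr a x z : mx_form D z (a *: x) = a * mx_form D z x.
Proof. by rewrite /mx_form -scalemxAr mxE. Qed.

Lemma mx_formC x y : D^T = D -> mx_form D x y = mx_form D y x.
Proof.
move=> symD; rewrite /mx_form -[in LHS](trmxK (x^T *m D *m y)) mxE.
by rewrite !trmx_mul trmxK symD mulmxA.
Qed.

Lemma mx_form_delta i j : mx_form D (delta_mx i 0) (delta_mx j 0) = D i j.
Proof. by rewrite /mx_form trmx_delta -rowE -colE !mxE. Qed.

End MxForm.

Lemma ler_entry_norm (R : realType) (m n : nat) (D : 'M[R]_(m, n)) i j :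
  `|D i j| <= `|D|.
Proof.
rewrite [X in _ <= X]mx_normrE.
exact: (le_bigmax _ (fun ij : 'I_m * 'I_n => `|D ij.1 ij.2|) (i, j)).
Qed.

Lemma ler_norm_sum_entries (R : realType) (m n : nat) (D : 'M[R]_(m, n)) :
  `|D| <= \sum_i \sum_j `|D i j|.
Proof.
rewrite pair_bigA /= [X in X <= _]mx_normrE.
apply/bigmax_leP; split; first exact: sumr_ge0.
by move=> ij _; rewrite (bigD1 ij) //= lerDl sumr_ge0.
Qed.

Lemma mx_form_bound (R : realType) (n : nat) (x y : 'cV[R]_n) :
  exists c : R, forall D : 'M[R]_n, `|mx_form D x y| <= c * `|D|.
Proof.
exists (\sum_i \sum_j `|x j 0| * `|y i 0|) => D.
rewrite /mx_form mxE (le_trans (ler_norm_sum _ _ _)) // mulr_suml.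
apply: ler_sum => i _; rewrite normrM mxE.
rewrite (le_trans (ler_wpM2r (normr_ge0 _) (ler_norm_sum _ _ _))) //.
rewrite !mulr_suml; apply: ler_sum => j _; rewrite normrM mxE.
by rewrite mulrAC ler_wpM2l ?mulr_ge0 ?normr_ge0 ?ler_entry_norm.
Qed.

(** * Directions [v] along which [D v] is [o(|D|)] *)

Section NegligibleDirections.
Variables (R : realType) (n : nat) (S : set 'M[R]_n) (A0 : 'M[R]_n).
Hypothesis symS : forall D, S D -> D^T = D.

(** The vector condition [D v = o(|D|)] is tested against each fixed [y], which keeps all estimates
    scalar. *)
Definition negligible_dir (v : 'cV[R]_n) : Prop :=
  forall y, negligible_on S (fun D => mx_form D y v).

Lemma negligible_dirD u v :
  negligible_dir u -> negligible_dir v -> negligible_dir (u + v).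
Proof.
move=> u0 v0 y; apply: eq_negligible (negligibleD (u0 y) (v0 y)) => D _.
by rewrite mx_formDr.
Qed.

Lemma negligible_dir_sum (I : Type) (r : seq I) (f : I -> 'cV[R]_n) :
  (forall i, negligible_dir (f i)) -> negligible_dir (\sum_(i <- r) f i).
Proof.
move=> f0 y; apply: eq_negligible (negligible_sum r (fun i => f0 i y)) => D _.
by rewrite /mx_form mulmx_sumr summxE.
Qed.

(* Positivity of [A0^T D + D A0] propagates the vanishing of its value at [v]
   to the vanishing of its product with [v]. *)
Lemma negligible_dir_mul v :
    (forall D, S D -> forall x, 0 <= mx_form D (A0 *m x) x) ->
  negligible_dir v -> negligible_dir (A0 *m v).
Proof.
move=> A0_ge0 v0 y; have [c cP] := mx_form_bound (A0 *m y) y.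
(* This is the cross term of the nonnegative form at [s *: y + v], a quadratic polynomial in [s].
   Its first summand is negligible by [v0]. *)
have polar : negligible_on S
    (fun D => mx_form D (A0 *m y) v + mx_form D y (A0 *m v)).
  apply: (negligible_quadratic (c := c) (q := fun D => mx_form D (A0 *m y) y)
           (g := fun D => mx_form D (A0 *m v) v)).
  - by move=> D _; apply: le_trans (ler_norm _) (cP D).
  - exact: v0.
  move=> D SD s; have := A0_ge0 D SD (s *: y + v).
  rewrite mulmxDr -scalemxAr !(mx_formDl, mx_formDr, mx_formZl, mx_formZr).
  by rewrite [mx_form D (A0 *m v) y]mx_formC ?symS //; lra.
apply: eq_negligible (negligibleD polar (negligibleN (v0 (A0 *m y)))) => D _.
by rewrite addrAC subrr add0r.
Qed.

(** Put [z = B^T D y]. Half of [|s z + u|^2 >= 0], with [|z|^2] replaced by its upper bound, is a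
    quadratic in [s] whose middle coefficient is the form at [(y, B u)] and whose constant term does
    not depend on [D]. *)
Lemma negligible_dir_range (m : nat) (B : 'M[R]_(n, m)) u :
    (forall D, S D -> forall x,
      ((B^T *m D *m x)^T *m (B^T *m D *m x)) 0 0 <= 2 * mx_form D (A0 *m x) x) ->
  negligible_dir (B *m u).
Proof.
move=> B_le y; have [c cP] := mx_form_bound (A0 *m y) y.
apply: (negligible_quadratic (c := c) (q := fun D => mx_form D (A0 *m y) y)
         (g := fun=> (u^T *m u) 0 0 / 2)).
- by move=> D _; apply: le_trans (ler_norm _) (cP D).
- exact: negligible_cst.
move=> D SD s; pose z := B^T *m D *m y.
have uz : (z^T *m u) 0 0 = mx_form D y (B *m u).
  by rewrite /mx_form /z !trmx_mul trmxK symS // !mulmxA.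
have zu : (u^T *m z) 0 0 = mx_form D y (B *m u).
  by rewrite -uz -[in RHS](trmxK (z^T *m u)) [RHS]mxE trmx_mul trmxK.
have := dotmx_ge0 (s *: z + u).
have -> : ((s *: z + u)^T *m (s *: z + u)) 0 0 =
    s ^+ 2 * (z^T *m z) 0 0 + 2 * s * mx_form D y (B *m u) + (u^T *m u) 0 0.
  have addE (M N : 'M[R]_1) : (M + N) 0 0 = M 0 0 + N 0 0 by rewrite mxE.
  have scaleE a (M : 'M[R]_1) : (a *: M) 0 0 = a * M 0 0 by rewrite mxE.
  rewrite [_^T]linearD /= [(s *: z)^T]linearZ /= mulmxDl !mulmxDr.
  rewrite -!scalemxAl -!scalemxAr.
  by rewrite !(addE, scaleE) uz zu; ring.
have : s ^+ 2 * (z^T *m z) 0 0 <= s ^+ 2 * (2 * mx_form D (A0 *m y) y).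
  by rewrite ler_wpM2l ?sqr_ge0 // B_le.
by lra.
Qed.

Lemma negligible_dirs_bounded : (forall v, negligible_dir v) ->
  exists M : R, forall D, S D -> `|D| <= M.
Proof.
move=> dirs0.
have [M bM] : exists M : R, forall D, S D -> M <= `|D| ->
    `|\sum_i \sum_j `|D i j| | <= 2^-1 * `|D|.
  suff /(_ 2^-1) : negligible_on S (fun D => \sum_i \sum_j `|D i j|).
    by apply; rewrite invr_gt0.
  apply: negligible_sum => i; apply: negligible_sum => j.
  apply: negligible_norm; apply: eq_negligible (dirs0 (delta_mx j 0) (delta_mx i 0)).
  by move=> D _; rewrite mx_form_delta.
(* Once [|D| >= M], the entry sum gives [|D| <= |D| / 2], so [|D| <= 0]; hence the maximum with
   [0]. *)
exists (Num.max M 0) => D SD; rewrite le_max.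
have [MD|/ltW -> //] := leP M `|D|.
have := bM D SD MD.
rewrite ger0_norm ?sumr_ge0 // => [le2|i _]; last exact: sumr_ge0.
by have := le_trans (ler_norm_sum_entries D) le2; lra.
Qed.

End NegligibleDirections.

(** * Controllability bounds the solution set *)

Lemma controllable_bounded (R : realType) (n m : nat)
    (A : 'M[R]_n) (B : 'M[R]_(n, m)) (Q K0 : 'M[R]_n) :
  K0^T = K0 -> riccati A B Q K0 = 0 -> controllable A B ->
  bounded_set [set K : 'M[R]_n | K^T = K /\ neg_semidef (riccati A B Q K)].
Proof.
move=> symK0 ricK0 ctrAB; pose A0 := A - B *m B^T *m K0.
pose S := [set D : 'M[R]_n | D^T = D /\
  neg_semidef (riccati A B Q (K0 + D))].
have symS D : S D -> D^T = D by case.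
(* The shifted inequality evaluated at [x]; by symmetry of [D] the two Lyapunov terms agree
   there. *)
have B_le D : S D -> forall x : 'cV_n,
    ((B^T *m D *m x)^T *m (B^T *m D *m x)) 0 0 <= 2 * mx_form D (A0 *m x) x.
  case=> symD [_ nsd] x; move: (nsd x); rewrite riccati_shift // ricK0 sub0r -/A0.
  clearbody A0; rewrite !(mulmxDl, mulmxDr, mulNmx, mulmxN).
  have addE (M N : 'M[R]_1) : (M + N) 0 0 = M 0 0 + N 0 0 by rewrite mxE.
  have oppE (M : 'M[R]_1) : (- M) 0 0 = - M 0 0 by rewrite mxE.
  have eqr : (x^T *m (D *m A0) *m x) 0 0 = mx_form D (A0 *m x) x.
    by rewrite mx_formC // /mx_form !mulmxA.
  have eql : (x^T *m (A0^T *m D) *m x) 0 0 = mx_form D (A0 *m x) x.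
    by rewrite /mx_form trmx_mul !mulmxA.
  rewrite !(addE, oppE) eqr eql !trmx_mul trmxK symD !mulmxA.
  by move=> le0; lra.
have A0_ge0 D : S D -> forall x, 0 <= mx_form D (A0 *m x) x.
  move=> SD x; have := le_trans (dotmx_ge0 _) (B_le D SD x).
  by rewrite pmulr_rge0.
have powAB i u : negligible_dir S (A ^+ i *m B *m u).
  elim: i u => [|i IHi] u.
    rewrite expr0 mul1mx; exact: negligible_dir_range B_le.
  pose v := A ^+ i *m B *m u.
  (* Since [A = A0 + B B^T K0], passing from [A0] to [A] only adds a vector in the range of [B]. *)
  have -> : A ^+ i.+1 *m B *m u = A0 *m v + B *m (B^T *m K0 *m v).
    by rewrite /A0 mulmxBl !mulmxA subrK exprS.
  apply: negligible_dirD; last exact: negligible_dir_range B_le.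
  exact: (negligible_dir_mul symS A0_ge0 (IHi u)).
have dirs v : negligible_dir S v.
  (* A right inverse [U] of the controllability matrix, cut into blocks [U_i], writes [v] as the sum
     of the [A^i B U_i v]. *)
  have /row_freeP [U ctrU] : row_free (ctrb_mx A B) by apply/eqP.
  rewrite -[v]mul1mx -ctrU -[U]submxcolK /ctrb_mx mul_mxrow_mxcol mulmx_suml.
  by apply: negligible_dir_sum => i; rewrite -mulmxA; apply: powAB.
have [M bM] := negligible_dirs_bounded dirs.
exists (M + `|K0|); split; first exact: num_real.
move=> N /ltW leN K [symK nsdK]; apply: le_trans leN.
rewrite -[K](subrK K0) (le_trans (ler_normD _ _)) // lerD2r bM //.
by split; [rewrite linearB /= symK symK0 | rewrite addrC subrK].
Qed.

Theorem theorem8 (R : realType) (n m : nat)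
    (A : 'M[R]_n) (B : 'M[R]_(n, m)) (Q : 'M[R]_n)
    (symQ : Q^T = Q)
    (solvable : exists K0 : 'M[R]_n, K0^T = K0 /\ riccati A B Q K0 = 0) :
  controllable A B <->
  bounded_set [set K : 'M[R]_n | K^T = K /\ neg_semidef (riccati A B Q K)].
Proof.
case: solvable => K0 [symK0 ricK0]; split; first exact: controllable_bounded ricK0.
move=> bnd; have [//|nctr] := \rank (ctrb_mx A B) =P n.
by case: (uncontrollable_unbounded symQ symK0 ricK0 nctr bnd).
Qed.
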